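(* For every $\epsilon>0$ there is a constant $C_\epsilon>0$, depending only on $\epsilon$, such that the following holds. Let $R\ge 1$ be such that $R^{1/2}$ is an integer, let $B_R=[0,R]^2\subset\mathbb R^2$, and let $\omega:B_R\to[0,\infty)$ be a (measurable) weight with $\omega(B_R)\le R$. For any complex sequence $\{a_n\}_{n=1}^{R^{1/2}}$, define $$G(x,t)=\sum_{n=1}^{R^{1/2}} a_n\, e\Big(\frac{n}{R^{1/2}}x+\frac{n^2}{R}t\Big),\qquad (x,t)\in B_R.$$ Then $$\int_{B_R}|G|^2\,\omega\ \le\ C_\epsilon R^\epsilon\,\Big(\sup_{T}\omega(T)^{1/2}\Big)\cdot R\,\|a_n\|_{l^2}^2,$$ where the supremum is over all tubes $T$ of dimensions $R\times R^{1/2}$.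
   Context: Notation: $e(z)=e^{2\pi i z}$ for $z\in\mathbb R$. For a set $A$, $\omega(A)=\int_A\omega$ (Lebesgue measure), with $\omega$ regarded as zero outside $B_R$. An $R\times R^{1/2}$ tube is a rectangle in the plane, in arbitrary direction, with side lengths $R$ and $R^{1/2}$. $\|a_n\|_{l^2}^2=\sum_n|a_n|^2$. *)

(* Defs.v *)
From HB Require Import structures.
From mathcomp Require Export all_boot all_order all_algebra.
From mathcomp Require Export complex.
From mathcomp Require Export all_classical all_reals all_analysis
  measurable_realfun.

Set Implicit Arguments.
Unset Strict Implicit.
Unset Printing Implicit Defensive.

Import Order.TTheory GRing.Theory Num.Theory.
Import numFieldNormedType.Exports.

Local Open Scope classical_set_scope.
Local Open Scope ring_scope.

Definition borel_lebesgue2 (K : realType) : set _ -> \bar K :=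
  (@lebesgue_measure K \x @lebesgue_measure K)%E.
HB.instance Definition _ (K : realType) := Measure.on (@borel_lebesgue2 K).

(* [K * K] with the Lebesgue (not only the Borel) sigma-algebra. *)
Definition plane (K : realType) : Type :=
  caratheodory_type (@borel_lebesgue2 K)^*%mu.
HB.instance Definition _ (K : realType) := Measurable.on (plane K).

(* Lebesgue measure on the plane: the library's [lebesgue_measure] lives on the
   Borel sets, hence the completion. *)
Definition lebesgue2 (K : realType) : set (plane K) -> \bar K :=
  @completed_measure_extension _ _ _ (@borel_lebesgue2 K).
HB.instance Definition _ (K : realType) := Measure.on (@lebesgue2 K).

Definition e {K : realType} (z : K) : K[i] :=
  Complex (cos (2 * pi * z)) (sin (2 * pi * z)).

Definition square {K : realType} (R : K) : set (plane K) :=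
  [set z | (0 <= z.1 <= R) && (0 <= z.2 <= R)].

(* [omega] is only ever evaluated on [square R]: this is the mass of the weight
   extended by zero outside of the square. *)
Definition weight_of {K : realType} (R : K) (omega : plane K -> K)
    (A : set (plane K)) : \bar K :=
  (\int[@lebesgue2 K]_(z in A `&` square R) (omega z)%:E)%E.

(* The rectangle with corner [c], side [l1] in the direction of the unit vector
   [u] and side [l2] in the direction of [u] rotated by a quarter turn. *)
Definition rectangle {K : realType} (c u : K * K) (l1 l2 : K) :
    set (plane K) :=
  [set z | exists r s : K, [/\ 0 <= r <= l1, 0 <= s <= l2 &
     z = (c.1 + r * u.1 - s * u.2, c.2 + r * u.2 + s * u.1)]].

Definition tube {K : realType} (R : K) : set (set (plane K)) :=
  [set T | exists c u : K * K,
     u.1 ^+ 2 + u.2 ^+ 2 = 1 /\ T = rectangle c u R (Num.sqrt R)].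

Definition G {K : realType} (R : K) (N : nat) (a : nat -> K[i])
    (z : plane K) : K[i] :=
  \sum_(1 <= n < N.+1)
    a n * e (n%:R / Num.sqrt R * z.1 + n%:R ^+ 2 / R * z.2).

(* Main.v *)
Require Import Defs.
From mathcomp Require Import zify ring lra.
Import Order.TTheory GRing.Theory Num.Theory.
Import numFieldNormedType.Exports.
Local Open Scope classical_set_scope.
Local Open Scope ring_scope.

(** Put R = N^2, let M be the total mass of omega and let W be the largest mass
    that omega gives to a horizontal tube, that is, to a time strip
    s <= t <= s + N. Write w(a, b) for the integral of omega against the wave
    exp(i (a x + b t)).

    Expanding the square,
      int |G|^2 omega = sum_(n, m) a_n conj(a_m)
        w(2 pi (n - m) / N, 2 pi (n^2 - m^2) / N^2),
    so by Cauchy-Schwarz ([pfun_square_modulus_le]) it is enough to bound the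
    sum of |w|^2 over all pairs (n, m) by a constant times N^(4 eps) N^4 W.

    The diagonal gives N M^2, and M is at most N W ([mass_le_strips]) as well as
    at most N^2. Off the diagonal put n = m + k: the frequency is
    (k / N, (k^2 + 2 k m) / N^2), which for fixed k runs, as m varies, through
    an arithmetic progression of step 2 k / N^2 in the time direction. Here the
    positivity of omega enters. A sum of |w|^2 over all lags p - q with
    p, q < L is a double integral of omega times omega against a product of a
    unimodular factor and of a nonnegative kernel, the square of a Dirichlet
    kernel; dropping the unimodular factor only increases it
    ([lag_energy_le]). This removes the space frequency and the shift k^2, and
    what remains is a sum of |w(0, 4 pi k r / N^2)|^2 over k <= N and r <= 2 N.

    The integer k r determines (k, r) up to d(k r) choices, and the divisor
    function is O(n^(2 eps)) by [size_divisors_le_powR]; so up to a factor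
    O(N^(4 eps)) the sum is at most the sum of |w(0, 4 pi j / N^2)|^2 over
    j <= 2 N^2. That is a large sieve sum ([time_energy_le]): it is at most
    N^(-2) times a double integral of omega times omega against a kernel which
    is O(N^4) when |t - t'| <= N and O(N^2) otherwise, and for fixed t' the
    first range is covered by two strips. Its value is O(M (N^2 W + M)), hence O(N^2 M W), and
    the estimate follows from M <= N^2.

    All integrals above are integrals of trigonometric polynomials and of
    indicators of strips, and only linearity and positivity of the integral
    are involved. The estimates are therefore proved for an abstract positive
    linear functional, with the wave sums written with real cosines and sines. *)

(** * The divisor bound *)

Section Divisors.
Local Open Scope nat_scope.

(** With q = a %/ k one has a + 1 <= k (q + 1) <= k 2^q, and 2^(q k) <= 2^a. *)
Lemma leq_succ_exp_exp2 k a : 0 < k -> a.+1 ^ k <= k ^ k * 2 ^ a.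
Proof.
move=> k0.
have h : a.+1 <= k * 2 ^ (a %/ k).
  have := ltn_expl (a %/ k) (isT : 1 < 2).
  have := divn_eq a k; have := ltn_pmod a k0.
  nia.
apply: (leq_trans (_ : _ <= (k * 2 ^ (a %/ k)) ^ k)); first by rewrite leq_exp2r.
by rewrite expnMn -expnM leq_mul2l leq_exp2l // leq_divM orbT.
Qed.

Lemma size_divisors_coprime_part n p : 0 < n -> prime p ->
  size (divisors n) <= (logn p n).+1 * size (divisors n`_p^').
Proof.
move=> n0 pp; set m := n`_p^'.
have m0 : 0 < m by rewrite part_gt0.
have := @uniq_leq_size _ (divisors n)
  [seq p ^ i * d | i <- iota 0 (logn p n).+1, d <- divisors m].
rewrite size_allpairs size_iota; apply; first exact: divisors_uniq.
move=> d; rewrite -dvdn_divisors // => dn.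
have d0 : 0 < d by exact: dvdn_gt0 dn.
apply/allpairsP; exists (logn p d, d`_p^'); split => /=.
- rewrite -[_ :: _]/(iota 0 (logn p n).+1) mem_iota /= add0n ltnS.
  exact: dvdn_leq_log.
- by rewrite -dvdn_divisors // partn_dvd.
- by rewrite -p_part partnC.
Qed.

(** The prime powers of n are split off one at a time, smallest prime first. A
    power p^a multiplies the left-hand side by (a + 1)^k at most. For p >= 2^k
    this is absorbed by p^a; each of the at most 2^k smaller primes costs a
    factor k^k. The lower bound B on the primes left is what makes this count
    an induction. *)
Lemma size_divisors_exp_leq_above k B n : 0 < k -> 0 < n ->
  {in primes n, forall p, B <= p} ->
  size (divisors n) ^ k <= (k ^ k) ^ (2 ^ k - B) * n.
Proof.
move=> k0; have kk0 : 0 < k ^ k by rewrite expn_gt0 k0.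
have [s] := ubnP n; elim: s n B => // s IH n B ns n0 pB.
have [->|n1] := eqVneq n 1.
  by rewrite [size _](_ : _ = 1) // exp1n muln1 expn_gt0 kk0.
have {}n1 : 1 < n by lia.
set p := pdiv n; have pp : prime p := pdiv_prime n1.
have ppn : p \in primes n by rewrite mem_primes pp n0 pdiv_dvd.
have Bp : B <= p by exact: pB.
(* the part of n prime to its smallest prime factor p *)
set m := n`_p^'.
have nE : n = p ^ logn p n * m by rewrite -p_part partnC.
have m0 : 0 < m by rewrite part_gt0.
have l0 : 0 < logn p n by rewrite logn_gt0.
have p1 := prime_gt1 pp.
have pl : p <= p ^ logn p n by rewrite -[leqLHS]expn1 leq_exp2l.
have mn : m < n by nia.
have hm : {in primes m, forall q, p.+1 <= q}.
  move=> q; rewrite primes_part mem_filter inE /= => /andP[].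
  rewrite inE => qp; rewrite mem_primes => /and3P[qpr _ qn].
  rewrite ltn_neqAle eq_sym qp /=; apply: pdiv_min_dvd => //.
  exact: prime_gt1.
have := IH m p.+1 (leq_trans mn ns) m0 hm.
have := size_divisors_coprime_part n p n0 pp; rewrite -/m => hd hI.
apply: (@leq_trans ((logn p n).+1 ^ k * size (divisors m) ^ k)).
  by rewrite -expnMn leq_exp2r.
rewrite [in leqRHS]nE.
have [pk|pk] := leqP (2 ^ k) p.
  have E : 2 ^ k - p.+1 = 0 by lia.
  move: hI; rewrite E expn0 mul1n => hI.
  apply: (@leq_trans (p ^ logn p n * m)); last by rewrite leq_pmull // expn_gt0 kk0.
  apply: leq_mul => //.
  apply: (@leq_trans ((2 ^ k) ^ logn p n)); last by rewrite leq_exp2r.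
  by rewrite -expnM mulnC expnM leq_exp2r // ltn_expl.
have -> : 2 ^ k - B = (1 + (2 ^ k - p.+1)) + (p - B) by lia.
rewrite !expnD expn1.
apply: (@leq_trans (k ^ k * p ^ logn p n * ((k ^ k) ^ (2 ^ k - p.+1) * m))).
  apply: leq_mul => //; apply: (leq_trans (leq_succ_exp_exp2 _ _ k0)).
  by rewrite leq_mul2l leq_exp2r // p1 orbT.
have : 0 < (k ^ k) ^ (p - B) by rewrite expn_gt0 kk0.
set a := _ ^ (p - B); set b := _ ^ (2 ^ k - p.+1); set d := p ^ logn p n.
move=> a0; rewrite -!mulnA leq_mul2l; apply/orP; right.
by rewrite mulnCA leq_mul2l leq_pmull ?orbT.
Qed.

(** The divisor bound d(n) = O(n^(1/k)), without roots. *)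
Lemma size_divisors_exp_leq k : 0 < k ->
  exists C, forall n, 0 < n -> size (divisors n) ^ k <= C * n.
Proof.
move=> k0; exists ((k ^ k) ^ (2 ^ k)) => n n0.
by have := @size_divisors_exp_leq_above k 0 n k0 n0; rewrite subn0; apply.
Qed.

End Divisors.

Lemma size_divisors_le_powR {K : realType} (eps : K) : 0 < eps ->
  exists2 C : K, 0 <= C & forall j n : nat, (0 < j <= n)%N ->
    (size (divisors j))%:R <= C * n%:R `^ eps.
Proof.
move=> eps0; set k := Num.bound eps^-1.
have ei : eps^-1 < k%:R by apply: archi_boundP; rewrite invr_ge0 ltW.
have kR0 : 0 < k%:R :> K by apply: lt_trans ei; rewrite invr_gt0.
have k0 : (0 < k)%N by rewrite -(ltr0n K).
have [C hC] := size_divisors_exp_leq k k0.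
exists (C%:R `^ k%:R^-1); first exact: powR_ge0.
move=> j n /andP[j0 jn].
have n1 : 1 <= n%:R :> K by rewrite ler1n; lia.
have -> : (size (divisors j))%:R = ((size (divisors j) ^ k)%N%:R : K) `^ k%:R^-1.
  by rewrite natrX -powR_mulrn// -powRrM divff ?powRr1// gt_eqF.
apply: (@le_trans _ _ ((C * n)%N%:R `^ k%:R^-1)).
  apply: ge0_ler_powR; rewrite ?invr_ge0 ?nnegrE ?ler0n// ler_nat.
  by apply: leq_trans (hC _ j0) _; rewrite leq_mul2l jn orbT.
rewrite natrM powRM ?ler0n// ler_wpM2l ?powR_ge0//.
apply: ler_powR => //; rewrite -[leRHS]invrK lef_pV2 ?posrE ?invr_gt0//.
exact: ltW.
Qed.

(** * The Dirichlet kernel *)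

Section Dirichlet_kernel.
Context {K : realType}.
Implicit Types u v : K.

(** The real part of exp(i u) |sum_p exp(i p v)|^2: the double sum of the sines
    of (p - q) v vanishes by antisymmetry. *)
Lemma sum_cos_lag L u v :
  \sum_(p < L) \sum_(q < L) cos (u + (p%:R - q%:R) * v) =
  cos u * ((\sum_(p < L) cos (p%:R * v)) ^+ 2 +
           (\sum_(p < L) sin (p%:R * v)) ^+ 2) :> K.
Proof.
set A := \sum_(p < L) cos (p%:R * v); set B := \sum_(p < L) sin (p%:R * v).
transitivity (\sum_(p < L) \sum_(q < L)
  (cos u * cos (p%:R * v) * cos (q%:R * v)
   + cos u * sin (p%:R * v) * sin (q%:R * v)
   - sin u * sin (p%:R * v) * cos (q%:R * v)
   + sin u * cos (p%:R * v) * sin (q%:R * v))).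
  apply: eq_bigr => p _; apply: eq_bigr => q _.
  by rewrite mulrBl cosD cosB sinB; ring.
under eq_bigr do rewrite !big_split /= sumrN -!mulr_sumr -/A -/B.
by rewrite !big_split /= sumrN -!mulr_suml -!mulr_sumr -/A -/B; ring.
Qed.

(** The squared modulus of the Dirichlet kernel of length L, see [dirichletE]. *)
Definition dirichlet L v : K :=
  \sum_(p < L) \sum_(q < L) cos ((p%:R - q%:R) * v).

Lemma dirichletE L v : dirichlet L v =
  (\sum_(p < L) cos (p%:R * v)) ^+ 2 + (\sum_(p < L) sin (p%:R * v)) ^+ 2.
Proof.
have /esym := sum_cos_lag L 0 v; rewrite cos0 mul1r => ->.
by apply: eq_bigr => p _; apply: eq_bigr => q _; rewrite add0r.
Qed.

Lemma sum_cos_lag_le L u v :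
  \sum_(p < L) \sum_(q < L) cos (u + (p%:R - q%:R) * v) <= dirichlet L v.
Proof.
rewrite sum_cos_lag dirichletE -[leRHS]mul1r ler_wpM2r ?cos_le1//.
by rewrite addr_ge0 ?sqr_ge0.
Qed.

Lemma dirichlet_le L v : dirichlet L v <= L%:R ^+ 2.
Proof.
apply: (@le_trans _ _ (\sum_(p < L) \sum_(q < L) 1)).
  by apply: ler_sum => p _; apply: ler_sum => q _; exact: cos_le1.
by rewrite !sumr_const !card_ord expr2 mulr_natr.
Qed.

(** The geometric sum: |sum_p exp(i p v)| |exp(i v) - 1| = |exp(i L v) - 1| <= 2,
    and |exp(i v) - 1| is at least |sin v|. *)
Lemma dirichlet_sin_le L v : dirichlet L v * sin v ^+ 2 <= 4.
Proof.
set A := \sum_(p < L) cos (p%:R * v); set B := \sum_(p < L) sin (p%:R * v).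
(* the telescoped geometric sum, in real and imaginary parts *)
have [hA hB] : (cos v - 1) * A - sin v * B = cos (L%:R * v) - 1 /\
  sin v * A + (cos v - 1) * B = sin (L%:R * v).
  rewrite /A /B; elim: L {A B} => [|L [IH1 IH2]].
    by rewrite !big_ord0 mul0r cos0 sin0; split; ring.
  rewrite !big_ord_recr /= -natr1 (mulrDl L%:R 1 v) mul1r cosD sinD; split.
  - by rewrite (mulrDr (cos v - 1)) (mulrDr (sin v)) opprD addrACA IH1; ring.
  - by rewrite (mulrDr (sin v)) (mulrDr (cos v - 1)) addrACA IH2; ring.
have key : dirichlet L v * ((cos v - 1) ^+ 2 + sin v ^+ 2) =
    2 - 2 * cos (L%:R * v).
  rewrite dirichletE -/A -/B.
  transitivity (((cos v - 1) * A - sin v * B) ^+ 2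
    + (sin v * A + (cos v - 1) * B) ^+ 2); first by ring.
  rewrite hA hB; have := cos2Dsin2 (L%:R * v).
  move: (cos _) (sin _) => c s; lra.
have D0 : 0 <= dirichlet L v by rewrite dirichletE addr_ge0 ?sqr_ge0.
have := cos_geN1 (L%:R * v).
have := mulr_ge0 D0 (sqr_ge0 (cos v - 1)).
move: key; rewrite mulrDr; lra.
Qed.

(** By the mean value theorem sin v = v cos c with c < 1/2, and
    cos c >= 1 - c >= 1/2. *)
Lemma sin_ge_half v : 0 <= v <= 2^-1 -> v / 2 <= sin v.
Proof.
move=> /andP[]; rewrite le_eqVlt => /predU1P[<- _|v0 v1].
  by rewrite sin0 mul0r.
have [c /[!in_itv]/= /andP[c0 cv]] := MVT v0 (fun x _ => is_derive_sin x)
  (continuous_subspaceT (@continuous_sin K)).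
rewrite sin0 !subr0 => ->; rewrite mulrC ler_wpM2r ?(ltW v0)//.
have [d _] := MVT c0 (fun x _ => is_derive_cos x)
  (continuous_subspaceT (@continuous_cos K)).
rewrite cos0 subr0 => h.
have := ler_wpM2r (ltW c0) (sin_le1 d); lra.
Qed.

Lemma dirichlet_far L v (b : K) : 0 < b -> b <= `|v| <= 2^-1 ->
  dirichlet L v <= 16 / b ^+ 2.
Proof.
move=> b0 /andP[bv v2]; rewrite ler_pdivlMr ?exprn_gt0//.
have s : b / 2 <= sin `|v|.
  apply: (@le_trans _ _ (`|v| / 2)); first by rewrite ler_wpM2r ?invr_ge0.
  by apply: sin_ge_half; rewrite v2 normr_ge0.
have sv : b ^+ 2 <= 4 * sin v ^+ 2.
  have -> : sin v ^+ 2 = sin `|v| ^+ 2.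
    by case: (ler0P v) => // _; rewrite sinN sqrrN.
  have b2 : 0 <= b / 2 by rewrite divr_ge0 ?(ltW b0).
  have : (b / 2) ^+ 2 <= sin `|v| ^+ 2 by rewrite lerXn2r ?nnegrE// (le_trans b2).
  rewrite expr_div_n; lra.
have D0 : 0 <= dirichlet L v by rewrite dirichletE addr_ge0 ?sqr_ge0.
have := dirichlet_sin_le L v.
have := ler_wpM2l D0 sv; lra.
Qed.

End Dirichlet_kernel.

(** * Finite sums *)

Section Sums.
Context {K : realType}.

Lemma ler_sum_widen (f : nat -> K) m n : (forall i, 0 <= f i) -> (m <= n)%N ->
  \sum_(i < m) f i <= \sum_(i < n) f i.
Proof.
move=> f0 mn; rewrite -!(big_mkord xpredT).
rewrite (@big_cat_nat _ _ _ m 0%N n) //= lerDl.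
by apply: sumr_ge0.
Qed.

Lemma ler_sum_shift (f : nat -> K) m n L : (forall i, 0 <= f i) ->
  (m + n <= L)%N -> \sum_(i < n) f (i + m)%N <= \sum_(i < L) f i.
Proof.
move=> f0 mnL.
have -> : \sum_(i < n) f (i + m)%N = \sum_(m <= i < m + n) f i.
  have := @big_addn _ 0 +%R 0%N (m + n) m xpredT f.
  by rewrite add0n addKn big_mkord => ->.
apply: le_trans (ler_sum_widen f _ _ f0 mnL).
rewrite -(big_mkord xpredT) (@big_cat_nat _ _ _ m 0%N (m + n)) ?leq_addr//=.
by rewrite lerDr; apply: sumr_ge0.
Qed.

(** Each lag m with 1 <= m <= L occurs at least L times as p - q with
    p, q < 2 L, namely once for each q < L. *)
Lemma sum_le_mean_lags (f : K -> K) L : (forall u, 0 <= f u) ->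
  L%:R * (\sum_(m < L) f m.+1%:R) <=
  \sum_(p < 2 * L) \sum_(q < 2 * L) f (p%:R - q%:R).
Proof.
move=> f0; rewrite exchange_big /=.
apply: (@le_trans _ _ (\sum_(q < L) \sum_(p < 2 * L) f (p%:R - q%:R))); last first.
  apply: (ler_sum_widen (fun q => \sum_(p < 2 * L) f (p%:R - q%:R))).
    by move=> q; apply: sumr_ge0.
  by rewrite leq_pmull.
rewrite mulr_natl -[L in _ *+ L]card_ord -sumr_const; apply: ler_sum => q _.
apply: le_trans (ler_sum_shift (fun p => f (p%:R - q%:R)) q.+1 L _ _ _) => //.
- apply: ler_sum => m _; suff -> : (m + q.+1)%N%:R - q%:R = m.+1%:R :> K by [].
  by rewrite addnS -addSn natrD addrK.
- by have := ltn_ord q; lia.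
Qed.

(** The entries below the diagonal are listed by their distance k + 1 to it;
    letting m run up to N on each of these lines only adds terms. *)
Lemma sum_symmetric_le (c : nat -> nat -> K) N :
  (forall n m, 0 <= c n m) -> (forall n m, c n m = c m n) ->
  \sum_(n < N) \sum_(m < N) c n m <=
  \sum_(m < N) c m m + 2 * \sum_(k < N) \sum_(m < N) c (m + k.+1)%N m.
Proof.
move=> c0 cC; rewrite [in leRHS]exchange_big /=.
have -> : \sum_(n < N) \sum_(m < N) c n m = \sum_(m < N) c m m +
    2 * \sum_(m < N) \sum_(n < N | (m < n)%N) c n m.
  have swap : \sum_(m < N) \sum_(n < N | (m < n)%N) c n m =
      \sum_(n < N) \sum_(m < N | (m < n)%N) c n m.
    by rewrite (exchange_big_dep predT).
  rewrite mulr_natl mulr2n {1}swap -!big_split /=; apply: eq_bigr => n _.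
  rewrite (bigD1 n) //=; congr (_ + _).
  rewrite (bigID (fun m : 'I_N => (m < n)%N)) /=; congr (_ + _).
    by apply: eq_bigl => m; rewrite ltn_neqAle andbA andbb.
  apply: eq_big => m; last by rewrite cC.
  by rewrite -leqNgt ltn_neqAle eq_sym.
rewrite lerD2l ler_pM2l// ; apply: ler_sum => m _.
have [mN|] := ltnP m N; last by have := ltn_ord m; lia.
rewrite -(big_mkord (fun n => (m < n)%N) (fun n => c n m)).
rewrite (@big_cat_nat _ _ _ m.+1 0%N N)//= big_nat_cond big_pred0 ?add0r; last first.
  by move=> i; case: ltnP => //=; lia.
rewrite big_nat_cond (eq_bigl (fun n => (m.+1 <= n < N)%N)); last by move=> n; lia.
rewrite -big_nat.
have := @big_addn _ 0 +%R 0%N N m.+1 xpredT (fun n => c n m).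
rewrite add0n => ->; rewrite big_mkord.
have := ler_sum_widen (fun k => c (k + m.+1)%N m) _ _ _ (leq_subr m.+1 N).
move=> /(_ _)/le_trans; apply => //.
by apply: ler_sum => k _; rewrite addnS -addSn addnC.
Qed.

Lemma sum_injective_le (n J : nat) (phi : 'I_n -> 'I_J) (P : pred 'I_J)
    (h : 'I_J -> K) : (forall j, 0 <= h j) -> injective phi ->
  (forall r, P (phi r)) -> \sum_(r < n) h (phi r) <= \sum_(j < J | P j) h j.
Proof.
move=> h0 phiI phiP.
have -> : \sum_(r < n) h (phi r) = \sum_(j in phi @: 'I_n) h j.
  by rewrite big_imset //=; move=> ? ? _ _ /phiI.
rewrite [leRHS](bigID (fun j => j \in phi @: 'I_n)) /=.
rewrite (eq_bigl (fun j => P j && (j \in phi @: 'I_n))).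
  by rewrite lerDl sumr_ge0.
by move=> j; apply/idP/andP => [|[]//]; case/imsetP => r _ ->; rewrite imset_f.
Qed.

(** An integer i is of the form c (k + 1) (r + 1) for at most d(i) pairs (k, r),
    since k + 1 divides i and determines r. *)
Lemma sum_products_le (h : nat -> K) (c n m J : nat) (D : K) : (forall j, 0 <= h j) ->
  (0 < c)%N -> (c * n * m <= J)%N ->
  (forall j, (0 < j <= J)%N -> (size (divisors j))%:R <= D) ->
  \sum_(k < n) \sum_(r < m) h (c * k.+1 * r.+1)%N
  <= D * \sum_(j < J) h j.+1.
Proof.
move=> h0 c0 cJ hD.
apply: (@le_trans _ _
    (\sum_(k < n) \sum_(j < J | (k.+1 %| j.+1)%N) h j.+1)).
  apply: ler_sum => k _.
  have lt r : (r < m)%N -> ((c * k.+1 * r.+1).-1 < J)%N.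
    move=> rm; have := ltn_ord k => kn.
    have : (c * k.+1 * r.+1 <= J)%N.
      by apply: leq_trans cJ; rewrite leq_mul// leq_mul.
    have : (0 < c * k.+1 * r.+1)%N by rewrite !muln_gt0 c0.
    by move: (c * _ * _)%N => x; lia.
  pose phi (r : 'I_m) : 'I_J := Ordinal (lt r (ltn_ord r)).
  have phiE r : (phi r).+1 = (c * k.+1 * r.+1)%N.
    by rewrite /= prednK// !muln_gt0 c0.
  under eq_bigr do rewrite -phiE.
  apply: (sum_injective_le m J phi (fun j => k.+1 %| j.+1)%N (fun j => h j.+1)).
  - by move=> ?.
  - move=> r s rs; apply: val_inj.
    have := phiE r; rewrite rs phiE => /eqP.
    by rewrite eqn_pmul2l ?muln_gt0 ?c0// eqSS => /eqP.
  - by move=> r; rewrite phiE mulnAC dvdn_mull.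
rewrite (exchange_big_dep predT) //= mulr_sumr; apply: ler_sum => j _.
rewrite sumr_const -[leLHS]mulr_natl ler_wpM2r//.
have dj : (size (divisors j.+1))%:R <= D by apply: hD; rewrite ltn_ord.
apply: le_trans dj; rewrite ler_nat.
rewrite cardE -(size_map (fun k : 'I_n => k.+1)); apply: uniq_leq_size.
  by rewrite map_inj_uniq ?enum_uniq// => x y [] /val_inj.
move=> d /mapP[k]; rewrite mem_enum => kj ->.
by rewrite -dvdn_divisors.
Qed.

(** Lagrange's identity. *)
Lemma sum_CauchySchwarz (J : finType) (u v : J -> K) :
  (\sum_i u i * v i) ^+ 2 <= (\sum_i u i ^+ 2) * (\sum_i v i ^+ 2).
Proof.
have : 0 <= \sum_i \sum_j (u i * v j - u j * v i) ^+ 2.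
  by apply: sumr_ge0 => i _; apply: sumr_ge0 => j _; exact: sqr_ge0.
suff -> : \sum_i \sum_j (u i * v j - u j * v i) ^+ 2 =
    2 * ((\sum_i u i ^+ 2) * (\sum_i v i ^+ 2) - (\sum_i u i * v i) ^+ 2).
  by rewrite pmulr_rge0// subr_ge0.
transitivity (\sum_i \sum_j (u i ^+ 2 * v j ^+ 2 + v i ^+ 2 * u j ^+ 2
    - 2 * (u i * v i) * (u j * v j))).
  by apply: eq_bigr => i _; apply: eq_bigr => j _; ring.
under eq_bigr do rewrite !big_split /= sumrN -!mulr_sumr.
by rewrite !big_split /= sumrN -!mulr_suml -!mulr_sumr; ring.
Qed.

End Sums.

(** * Energies of a positive functional *)

(** The integral against the weight, reduced to what the estimates use: a
    functional that is linear on a vector space of test functions containing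
    the constants and nonnegative on the test functions that are nonnegative
    on [Q]. *)
Record positive_functional (K : realType) (T : Type) (Q : set T) := {
  test : set (T -> K) ;
  pfun : (T -> K) -> K ;
  test_cst : forall c, test (fun=> c) ;
  testD : forall f g, test f -> test g -> test (fun z => f z + g z) ;
  testZ : forall c f, test f -> test (fun z => c * f z) ;
  pfunD : forall f g, test f -> test g ->
    pfun (fun z => f z + g z) = pfun f + pfun g ;
  pfunZ : forall c f, test f -> pfun (fun z => c * f z) = c * pfun f ;
  pfun_ge0 : forall f, test f -> (forall z, Q z -> 0 <= f z) -> 0 <= pfun f }.

Arguments test {K T Q}.
Arguments pfun {K T Q}.

Section Energy.
Context {K : realType} {T : Type} {Q : set T} (I : positive_functional K T Q).
Implicit Types f g : T -> K.

Let mass : K := pfun I (fun=> 1).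

Lemma pfun_cst c : pfun I (fun=> c) = c * mass.
Proof.
rewrite -pfunZ; last exact: test_cst.
by congr pfun; apply/funext => z; rewrite mulr1.
Qed.

Lemma pfun_le f g : test I f -> test I g -> (forall z, Q z -> f z <= g z) ->
  pfun I f <= pfun I g.
Proof.
move=> tf tg fg; rewrite -subr_ge0.
have -> : pfun I g - pfun I f = pfun I (fun z => g z + -1 * f z).
  by rewrite pfunD ?pfunZ ?mulN1r//; exact: testZ.
apply: pfun_ge0; first by apply: testD => //; exact: testZ.
by move=> z /fg; rewrite mulN1r subr_ge0.
Qed.

Lemma test_sum (J : Type) (r : seq J) (F : J -> T -> K) :
  (forall j, test I (F j)) -> test I (fun z => \sum_(j <- r) F j z).
Proof.
move=> tF; elim: r => [|j r IH].
  by under eq_fun do rewrite big_nil; exact: test_cst.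
by under eq_fun do rewrite big_cons; exact: testD.
Qed.

Lemma pfun_sum (J : Type) (r : seq J) (F : J -> T -> K) :
  (forall j, test I (F j)) ->
  pfun I (fun z => \sum_(j <- r) F j z) = \sum_(j <- r) pfun I (F j).
Proof.
move=> tF; elim: r => [|j r IH].
  by under eq_fun do rewrite big_nil; rewrite big_nil pfun_cst mul0r.
under eq_fun do rewrite big_cons.
by rewrite big_cons pfunD ?IH//; exact: test_sum.
Qed.

Definition phase (al : T -> K) : Prop :=
  test I (fun z => cos (al z)) /\ test I (fun z => sin (al z)).

(** The squared modulus of the integral of exp(i al). *)
Definition energy (al : T -> K) : K :=
  pfun I (fun z => cos (al z)) ^+ 2 + pfun I (fun z => sin (al z)) ^+ 2.

Lemma energy_ge0 al : 0 <= energy al.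
Proof. by rewrite addr_ge0 ?sqr_ge0. Qed.

Lemma energyN al : phase al -> energy (fun z => - al z) = energy al.
Proof.
move=> [_ ts]; rewrite /energy; congr (_ + _).
  by under eq_fun do rewrite cosN.
under eq_fun do rewrite sinN -mulN1r.
by rewrite pfunZ// mulN1r sqrrN.
Qed.

Lemma energy0 : energy (fun=> 0) = mass ^+ 2.
Proof. by rewrite /energy cos0 sin0 (pfun_cst 0) mul0r expr0n addr0. Qed.

Lemma test_cosB al c : phase al -> test I (fun z => cos (c - al z)).
Proof.
by move=> [tc ts]; under eq_fun do rewrite cosB; apply: testD; exact: testZ.
Qed.

Lemma pfun_cosB al c : phase al -> pfun I (fun z => cos (c - al z)) =
  pfun I (fun z => cos (al z)) * cos c + pfun I (fun z => sin (al z)) * sin c.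
Proof.
move=> [tc ts]; under eq_fun do rewrite cosB.
rewrite pfunD ?pfunZ ?[cos c * _]mulrC ?[sin c * _]mulrC//; exact: testZ.
Qed.

Lemma test_pfun_cosB al : phase al ->
  test I (fun z => pfun I (fun z' => cos (al z - al z'))).
Proof.
move=> pal; have [tc ts] := pal; under eq_fun do rewrite pfun_cosB//.
by apply: testD; exact: testZ.
Qed.

(** The square of an integral is a double integral, the inner one being a
    combination of cos al and sin al; this is Fubini for
    kernels of finite rank. *)
Lemma energyE al : phase al ->
  energy al = pfun I (fun z => pfun I (fun z' => cos (al z - al z'))).
Proof.
move=> pal; have [tc ts] := pal; under eq_fun do rewrite pfun_cosB//.
by rewrite pfunD ?pfunZ//; exact: testZ.
Qed.

Lemma pfun_kernel (J : finType) (al : J -> T -> K) : (forall j, phase (al j)) ->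
  (fun z => pfun I (fun z' => \sum_j cos (al j z - al j z'))) =
  (fun z => \sum_j pfun I (fun z' => cos (al j z - al j z'))).
Proof.
move=> pal; apply/funext => z.
by apply: (pfun_sum _ _ (fun j z' => cos (al j z - al j z'))) => j; exact: test_cosB.
Qed.

Lemma sum_energyE (J : finType) (al : J -> T -> K) : (forall j, phase (al j)) ->
  \sum_j energy (al j) =
  pfun I (fun z => pfun I (fun z' => \sum_j cos (al j z - al j z'))).
Proof.
move=> pal; rewrite pfun_kernel// pfun_sum => [|j]; last exact: test_pfun_cosB.
by apply: eq_bigr => j _; rewrite energyE.
Qed.

Lemma test_kernel (J : finType) (al : J -> T -> K) z :
  (forall j, phase (al j)) -> test I (fun z' => \sum_j cos (al j z - al j z')).
Proof.
move=> pal; apply: (test_sum _ _ (fun j z' => cos (al j z - al j z'))) => j.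
exact: test_cosB.
Qed.

Lemma test_pfun_kernel (J : finType) (al : J -> T -> K) :
  (forall j, phase (al j)) ->
  test I (fun z => pfun I (fun z' => \sum_j cos (al j z - al j z'))).
Proof.
move=> pal; rewrite pfun_kernel//; apply: test_sum => j; exact: test_pfun_cosB.
Qed.

(** The form in which positivity is used: pointwise comparison of the kernels of
    two sums of energies compares the sums. *)
Lemma sum_energy_le (J J' : finType) (al : J -> T -> K) (be : J' -> T -> K) :
  (forall j, phase (al j)) -> (forall j, phase (be j)) ->
  (forall z z', Q z -> Q z' ->
    \sum_j cos (al j z - al j z') <= \sum_j cos (be j z - be j z')) ->
  \sum_j energy (al j) <= \sum_j energy (be j).
Proof.
move=> pal pbe ab; rewrite !sum_energyE//.
apply: pfun_le; [exact: test_pfun_kernel..|move=> z Qz].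
by apply: pfun_le; [exact: test_kernel..|move=> z' Qz'; exact: ab].
Qed.

Lemma sum_energy_le_mass (J : finType) (al : J -> T -> K) c :
  (forall j, phase (al j)) ->
  (forall z, Q z -> pfun I (fun z' => \sum_j cos (al j z - al j z')) <= c) ->
  \sum_j energy (al j) <= c * mass.
Proof.
move=> pal ac; rewrite sum_energyE// -pfun_cst.
by apply: pfun_le => //; [exact: test_pfun_kernel|exact: test_cst].
Qed.

(** The expansion of |sum_j (x_j + i y_j) exp(i al_j)|^2, whose real and imaginary
    parts are the two sums on the left. *)
Lemma square_modulusE (J : finType) (x y al : J -> K) :
  (\sum_j (x j * cos (al j) - y j * sin (al j))) ^+ 2 +
  (\sum_j (x j * sin (al j) + y j * cos (al j))) ^+ 2 =
  \sum_(k : J * J) ((x k.1 * x k.2 + y k.1 * y k.2) * cos (al k.1 - al k.2) +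
                    (x k.1 * y k.2 - y k.1 * x k.2) * sin (al k.1 - al k.2)).
Proof.
rewrite -(pair_bigA _ (fun i j => (x i * x j + y i * y j) * cos (al i - al j) +
  (x i * y j - y i * x j) * sin (al i - al j))) /=.
rewrite !expr2 !big_distrlr -big_split /=.
apply: eq_bigr => i _; rewrite -big_split /=; apply: eq_bigr => j _.
by rewrite cosB sinB; ring.
Qed.

Lemma test_square_modulus (J : finType) (x y : J -> K) (al : J -> T -> K) :
  (forall i j, phase (fun z => al i z - al j z)) ->
  test I (fun z => (\sum_j (x j * cos (al j z) - y j * sin (al j z))) ^+ 2 +
           (\sum_j (x j * sin (al j z) + y j * cos (al j z))) ^+ 2).
Proof.
move=> pal; under eq_fun do rewrite square_modulusE; apply: test_sum => -[i j] /=.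
by have [tc ts] := pal i j; apply: testD; exact: testZ.
Qed.

(** Cauchy-Schwarz over the terms of [square_modulusE]. The coefficients P and R
    are the real and imaginary parts of conj(a_i) a_j, where a_j has parts x_j
    and y_j, so P^2 + R^2 = |a_i|^2 |a_j|^2. *)
Lemma pfun_square_modulus_le (J : finType) (x y : J -> K) (al : J -> T -> K) :
  (forall i j, phase (fun z => al i z - al j z)) ->
  (pfun I (fun z => (\sum_j (x j * cos (al j z) - y j * sin (al j z))) ^+ 2 +
           (\sum_j (x j * sin (al j z) + y j * cos (al j z))) ^+ 2)) ^+ 2 <=
  (\sum_j (x j ^+ 2 + y j ^+ 2)) ^+ 2 *
  \sum_i \sum_j energy (fun z => al i z - al j z).
Proof.
move=> pal; under eq_fun do rewrite square_modulusE.
pose P i j := x i * x j + y i * y j; pose R i j := x i * y j - y i * x j.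
rewrite pfun_sum; last first.
  by move=> [i j] /=; have [tc ts] := pal i j; apply: testD; exact: testZ.
(* the boolean index selects the cosine or the sine term *)
pose C (b : bool) i j := pfun I (fun z =>
  if b then cos (al i z - al j z) else sin (al i z - al j z)).
pose u (k : J * J * bool) := if k.2 then P k.1.1 k.1.2 else R k.1.1 k.1.2.
pose v (k : J * J * bool) := C k.2 k.1.1 k.1.2.
rewrite (_ : \sum_k _ = \sum_k u k * v k); last first.
  rewrite -(pair_bigA _ (fun k b => u (k, b) * v (k, b))) /=.
  apply: eq_bigr => -[i j] _ /=; rewrite big_bool /u /v /C /=.
  have [tc ts] := pal i j; rewrite pfunD ?pfunZ//; exact: testZ.
apply: (le_trans (sum_CauchySchwarz _ _ _)).
rewrite le_eqVlt; apply/orP; left; apply/eqP; congr (_ * _).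
  rewrite -(pair_bigA _ (fun k b => u (k, b) ^+ 2)) /=.
  rewrite expr2 big_distrlr [RHS]pair_bigA; apply: eq_bigr => -[i j] _ /=.
  by rewrite big_bool /u /P /R /=; ring.
rewrite -(pair_bigA _ (fun k b => v (k, b) ^+ 2)) /=.
by rewrite [RHS]pair_bigA; apply: eq_bigr => -[i j] _ /=; rewrite big_bool.
Qed.

End Energy.

(** * Energies on the parabola *)

Section Strips.
Context {K : realType} {T : Type} {Q : set T} (I : positive_functional K T Q).
Context (xi tau : T -> K) (N : nat) (W : K).
Hypothesis N0 : (0 < N)%N.
Hypothesis xi_tau_phase : forall a b, phase I (fun z => a * xi z + b * tau z).
Hypothesis tauQ : forall z, Q z -> 0 <= tau z <= N%:R ^+ 2.
Let strip (s : K) (z : T) : K := (s <= tau z <= s + N%:R)%R%:R.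
Hypothesis strip_test : forall s, test I (strip s).
Hypothesis strip_le : forall s, pfun I (strip s) <= W.

Let mass : K := pfun I (fun=> 1).
(* the squared Fourier coefficient of the weight at the frequency (a, b) *)
Let E a b : K := energy I (fun z => a * xi z + b * tau z).

Let E_ge0 a b : 0 <= E a b. Proof. exact: energy_ge0. Qed.

Let EN a b : E (- a) (- b) = E a b.
Proof.
rewrite /E -[RHS](energyN _ _ (xi_tau_phase a b)).
by congr energy; apply/funext => z; ring.
Qed.

Let E00 : E 0 0 = mass ^+ 2.
Proof.
by rewrite /E -energy0; congr energy; apply/funext => z; rewrite !mul0r addr0.
Qed.

Let NR0 : 0 < N%:R :> K. Proof. by rewrite ltr0n. Qed.

Let mass_ge0 : 0 <= mass.
Proof. by apply: pfun_ge0 => [|z _]; [exact: test_cst|exact: ler01]. Qed.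

Let strip_ge0 s z : 0 <= strip s z. Proof. by rewrite /strip ler0n. Qed.

Let W_ge0 : 0 <= W.
Proof. by apply: le_trans (strip_le 0); apply: pfun_ge0. Qed.

(** The strips with s = 0, N, ..., (N - 1) N cover the range of [tau]. *)
Lemma mass_le_strips : mass <= N%:R * W.
Proof.
have cover k z : 0 <= tau z <= k.+1%:R * N%:R ->
    1 <= \sum_(i < k.+1) strip (i%:R * N%:R) z.
  elim: k => [|k IH] tz.
    by rewrite big_ord1 /strip mul0r add0r; move: tz; rewrite mul1r => ->.
  rewrite big_ord_recr /=; have [tk|tk] := leP (tau z) (k.+1%:R * N%:R).
    apply: le_trans (_ : \sum_(i < k.+1) strip (i%:R * N%:R) z <= _).
      by apply: IH; rewrite tk; case/andP: tz => ->.
    by rewrite lerDl.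
  apply: le_trans (_ : strip (k.+1%:R * N%:R) z <= _); last first.
    by rewrite lerDr; apply: sumr_ge0.
  rewrite /strip (ltW tk) /=; case/andP: tz => _.
  by rewrite -[k.+2%:R]natr1 mulrDl mul1r => ->.
apply: (@le_trans _ _ (pfun I (fun z => \sum_(i < N) strip (i%:R * N%:R) z))).
  apply: pfun_le => [||z /tauQ]; [exact: test_cst|exact: test_sum|].
  by have := cover N.-1 z; rewrite prednK// expr2.
rewrite pfun_sum// mulr_natl -[N in leRHS]card_ord -sumr_const.
by apply: ler_sum => i _; exact: strip_le.
Qed.

(** The kernel on the left is cos(u) times the squared Dirichlet kernel on the
    right, where u contains the space frequency a and the shift b. *)
Lemma lag_energy_le L a b d :
  \sum_(p < L) \sum_(q < L) E a (b + (p%:R - q%:R) * d) <=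
  \sum_(p < L) \sum_(q < L) E 0 ((p%:R - q%:R) * d).
Proof.
rewrite !pair_bigA /= /E; apply: sum_energy_le => //= z z' _ _.
set u := a * (xi z - xi z') + b * (tau z - tau z').
set v := d * (tau z - tau z').
rewrite (eq_bigr (fun k : 'I_L * 'I_L => cos (u + (k.1%:R - k.2%:R) * v))); last first.
  by move=> [p q] _ /=; congr cos; rewrite /u /v; ring.
rewrite [leRHS](eq_bigr (fun k : 'I_L * 'I_L => cos ((k.1%:R - k.2%:R) * v))); last first.
  by move=> [p q] _ /=; congr cos; rewrite /v; ring.
rewrite -(pair_bigA _ (fun p q : 'I_L => cos (u + (p%:R - q%:R) * v))).
rewrite -(pair_bigA _ (fun p q : 'I_L => cos ((p%:R - q%:R) * v))).
exact: sum_cos_lag_le.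
Qed.

(** The energy is an even function of the lag, so the lags of both signs are
    counted together. *)
Lemma lag_energy_sum_le L d :
  \sum_(p < L) \sum_(q < L) E 0 ((p%:R - q%:R) * d) <=
  L%:R * mass ^+ 2 + 2 * L%:R * \sum_(r < L) E 0 (r.+1%:R * d).
Proof.
have := sum_symmetric_le (fun p q => E 0 ((p%:R - q%:R) * d)) L
  (fun p q => E_ge0 _ _).
move/(_ _)/le_trans; apply.
  by move=> p q; rewrite -EN oppr0 -mulNr opprB.
under eq_bigr do rewrite subrr mul0r E00.
rewrite sumr_const card_ord -[_ *+ _]mulr_natl lerD2l -mulrA ler_pM2l//.
under eq_bigr => k _.
  under eq_bigr => m _ do rewrite natrD addrAC subrr add0r.
  rewrite sumr_const card_ord -[_ *+ _]mulr_natl.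
  over.
by rewrite /= mulr_sumr.
Qed.

Lemma progression_energy_le L a b d :
  L%:R * \sum_(m < L) E a (b + m.+1%:R * d) <=
  \sum_(p < 2 * L) \sum_(q < 2 * L) E 0 ((p%:R - q%:R) * d).
Proof.
apply: le_trans (lag_energy_le _ a b d).
exact: (sum_le_mean_lags (fun u => E a (b + u * d))).
Qed.

(* The step delta is so small that the angle delta (tau z - tau z') is at most
   pi / 8 < 1/2 on the whole range of tau, where the Dirichlet kernel has a
   single peak. The frequencies 4 pi j / N^2 that occur below are the multiples
   32 j of delta, and j <= 2 N^2 gives the length J = 32 * (2 N^2). *)
Let J := (64 * N ^ 2)%N.
Let delta : K := pi / (8 * N%:R ^+ 2).

Let JE : J%:R = 64 * N%:R ^+ 2 :> K. Proof. by rewrite natrM natrX. Qed.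

Let J0 : 0 < J%:R :> K. Proof. by rewrite JE mulr_gt0// exprn_gt0. Qed.

(** Two times at distance at most N lie in a common strip, where the kernel is
    at most (2 J)^2. Otherwise the angle is at least delta N >= 1 / (4 N), and
    the decay of the Dirichlet kernel gives 16 (4 N)^2 = 4 J. *)
Lemma dirichlet_le_strips z z' : Q z -> Q z' ->
  dirichlet (2 * J) (delta * (tau z - tau z')) <=
  4 * J%:R ^+ 2 * (strip (tau z - N%:R) z' + strip (tau z) z') + 4 * J%:R.
Proof.
move=> /tauQ/andP[z0 zN] /tauQ/andP[z'0 z'N].
have J4 : 0 <= 4 * J%:R ^+ 2 :> K by rewrite mulr_ge0.
have [near|far] := leP `|tau z - tau z'| N%:R.
  apply: (le_trans (dirichlet_le _ _)).
  have -> : (2 * J)%:R ^+ 2 = 4 * J%:R ^+ 2 :> K by rewrite natrM; ring.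
  apply: ler_wpDr; first by rewrite mulr_ge0.
  rewrite -[leLHS]mulr1 ler_wpM2l//.
  move: near; rewrite ler_norml => /andP[near1 near2].
  have [le|lt] := leP (tau z) (tau z').
    suff -> : strip (tau z) z' = 1 by rewrite lerDr.
    rewrite /strip le (_ : tau z' <= _ = true)//; lra.
  suff -> : strip (tau z - N%:R) z' = 1 by rewrite lerDl.
  rewrite /strip subrK (ltW lt) (_ : _ <= tau z' = true)//; lra.
apply: (@le_trans _ _ (4 * J%:R)); last first.
  by rewrite lerDr mulr_ge0// addr_ge0.
have d0 : 0 < delta by rewrite divr_gt0 ?pi_gt0// mulr_gt0// exprn_gt0.
have b0 : 0 < (4 * N%:R)^-1 :> K by rewrite invr_gt0 mulr_gt0.
have -> : 4 * J%:R = 16 / (4 * N%:R)^-1 ^+ 2 :> K.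
  by rewrite JE; field; rewrite gt_eqF.
apply: dirichlet_far => //; rewrite normrM (gtr0_norm d0); apply/andP; split.
  apply: (@le_trans _ _ (delta * N%:R)); last by rewrite ler_pM2l// ltW.
  rewrite (_ : delta * N%:R = pi / 2 * (4 * N%:R)^-1); last first.
    by rewrite /delta; field; rewrite gt_eqF.
  by rewrite -[leLHS]mul1r ler_wpM2r ?(ltW b0) ?pihalf_ge1.
apply: (@le_trans _ _ (delta * N%:R ^+ 2)).
  by rewrite ler_pM2l// ler_norml; lra.
rewrite (_ : delta * N%:R ^+ 2 = pi / 2 / 4); last first.
  by rewrite /delta; field; rewrite gt_eqF.
have := @pihalf_lt2 K; lra.
Qed.

(** The large sieve: J times the left-hand side is at most the double integral of
    the kernel of [dirichlet_le_strips]. *)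
Lemma time_energy_le : \sum_(j < J) E 0 (j.+1%:R * delta) <=
  mass * (512 * N%:R ^+ 2 * W + 4 * mass).
Proof.
rewrite -(ler_pM2l J0).
have := progression_energy_le J 0 0 delta.
under eq_bigr do rewrite add0r.
move/le_trans; apply; rewrite pair_bigA /= /E.
have -> : J%:R * (mass * (512 * N%:R ^+ 2 * W + 4 * mass)) =
  (4 * J%:R ^+ 2 * (W + W) + 4 * J%:R * mass) * mass by rewrite JE; ring.
apply: sum_energy_le_mass => //= z Qz.
have kE z' : \sum_(k : 'I_(2 * J) * 'I_(2 * J)) cos
    (0 * xi z + (k.1%:R - k.2%:R) * delta * tau z -
    (0 * xi z' + (k.1%:R - k.2%:R) * delta * tau z')) =
    dirichlet (2 * J) (delta * (tau z - tau z')).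
  rewrite /dirichlet pair_bigA /=; apply: eq_bigr => -[p q] _ /=.
  by congr cos; ring.
have tk := test_kernel I _ (fun (k : 'I_(2 * J) * 'I_(2 * J)) w =>
  0 * xi w + (k.1%:R - k.2%:R) * delta * tau w) z.
have tS : test I (fun z' => 4 * J%:R ^+ 2 * (strip (tau z - N%:R) z' + strip (tau z) z')).
  by apply: testZ; exact: testD.
apply: (@le_trans _ _ (pfun I (fun z' =>
  4 * J%:R ^+ 2 * (strip (tau z - N%:R) z' + strip (tau z) z') + 4 * J%:R))).
  apply: pfun_le => [||z' Qz'].
  - by apply: tk => k.
  - apply: testD => //; exact: test_cst.
  - by rewrite kE; exact: dirichlet_le_strips.
rewrite pfunD//; last exact: test_cst.
rewrite pfunZ; last exact: testD.
rewrite pfunD// pfun_cst lerD2r ler_wpM2l ?mulr_ge0//.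
by apply: lerD; exact: strip_le.
Qed.

Hypothesis mass_le : mass <= N%:R ^+ 2.

(** The frequencies are differences of points (n / N, n^2 / N^2) of the parabola.
    On the line n = m + k + 1 they form an arithmetic progression in m of step
    2 (k + 1) / N^2 in the second coordinate. *)
Lemma parabola_energy_le (D : K) :
  (forall j, (0 < j <= J)%N -> (size (divisors j))%:R <= D) ->
  \sum_(n < N) \sum_(m < N)
    E ((n.+1%:R - m.+1%:R) * (2 * pi / N%:R))
      ((n.+1%:R ^+ 2 - m.+1%:R ^+ 2) * (2 * pi / N%:R ^+ 2)) <=
  4133 * D * N%:R ^+ 4 * W.
Proof.
move=> hD; set al := 2 * pi / N%:R; set be := 2 * pi / N%:R ^+ 2.
have := sum_symmetric_le (fun n m => E ((n.+1%:R - m.+1%:R) * al)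
  ((n.+1%:R ^+ 2 - m.+1%:R ^+ 2) * be)) N (fun _ _ => E_ge0 _ _).
move/(_ _)/le_trans; apply.
  by move=> n m; rewrite -EN; congr (E _ _); rewrite -mulNr opprB.
under eq_bigr do rewrite !subrr !mul0r E00.
rewrite sumr_const card_ord -[_ *+ _]mulr_natl.
pose h j := E 0 (j%:R * delta).
(* at distance k + 1 from the diagonal the frequencies form a progression *)
have line k : \sum_(m < N) E (((m + k.+1)%N.+1%:R - m.+1%:R) * al)
    (((m + k.+1)%N.+1%:R ^+ 2 - m.+1%:R ^+ 2) * be) <=
    2 * mass ^+ 2 + 4 * \sum_(r < 2 * N) h (32 * k.+1 * r.+1)%N.
  rewrite -(ler_pM2l NR0).
  have := progression_energy_le N (k.+1%:R * al) (k.+1%:R ^+ 2 * be)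
    (2 * k.+1%:R * be).
  under eq_bigr => m _.
    have -> : k.+1%:R * al = ((m + k.+1)%N.+1%:R - m.+1%:R) * al.
      by rewrite -addSn natrD; ring.
    have -> : k.+1%:R ^+ 2 * be + m.+1%:R * (2 * k.+1%:R * be) =
        ((m + k.+1)%N.+1%:R ^+ 2 - m.+1%:R ^+ 2) * be.
      by rewrite -addSn natrD; ring.
    over.
  move/le_trans; apply; apply: (le_trans (lag_energy_sum_le _ _)).
  rewrite le_eqVlt; apply/orP; left; apply/eqP.
  have -> : \sum_(r < 2 * N) E 0 (r.+1%:R * (2 * k.+1%:R * be)) =
      \sum_(r < 2 * N) h (32 * k.+1 * r.+1)%N.
    apply: eq_bigr => r _; rewrite /h; congr (E 0 _).
    by rewrite !natrM /be /delta; field; rewrite gt_eqF.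
  by rewrite natrM; ring.
have D1 : 1 <= D by apply: (hD 1%N); rewrite muln_gt0 expn_gt0 N0.
have D0 : 0 <= D by exact: le_trans D1.
(* the lines together: each multiple of delta occurs at most D times *)
have off : \sum_(k < N) \sum_(m < N) E (((m + k.+1)%N.+1%:R - m.+1%:R) * al)
    (((m + k.+1)%N.+1%:R ^+ 2 - m.+1%:R ^+ 2) * be) <=
    N%:R * (2 * mass ^+ 2) + 4 * (D * (mass * (512 * N%:R ^+ 2 * W + 4 * mass))).
  apply: (@le_trans _ _ (\sum_(k < N) (2 * mass ^+ 2 +
      4 * \sum_(r < 2 * N) h (32 * k.+1 * r.+1)%N))).
    by apply: ler_sum => k _; exact: line.
  rewrite big_split /= sumr_const card_ord -[_ *+ _]mulr_natl lerD2l -mulr_sumr.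
  rewrite ler_pM2l//.
  apply: (le_trans (sum_products_le h 32 N (2 * N) J D _ _ _ _)) => //.
  - by move=> j; exact: E_ge0.
  - by rewrite /J mulnACA mulnn.
  - by rewrite ler_wpM2l//; exact: time_energy_le.
have N1 : 1 <= N%:R :> K by rewrite ler1n.
have mW : mass <= N%:R ^+ 2 * W.
  apply: (le_trans mass_le_strips); rewrite ler_wpM2r//.
  by rewrite expr2 -[leLHS]mul1r ler_wpM2r.
have NW : N%:R * mass <= N%:R ^+ 2 * W.
  by rewrite expr2 -mulrA ler_pM2l// mass_le_strips.
set X := N%:R ^+ 2 * W in mW NW *.
have X0 : 0 <= X by rewrite mulr_ge0// exprn_ge0.
have step : N%:R * mass ^+ 2 + 2 * (\sum_(k < N) \sum_(m < N)
    E (((m + k.+1)%N.+1%:R - m.+1%:R) * al)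
    (((m + k.+1)%N.+1%:R ^+ 2 - m.+1%:R ^+ 2) * be)) <= 4133 * D * (mass * X).
  apply: (@le_trans _ _ (5 * (mass * (N%:R * mass)) +
      8 * (D * (mass * (512 * X + 4 * mass))))).
    move: off; rewrite -(mulrA 512) -/X.
    move: (\sum_(k < N) _) (D * (mass * _)) => S Y.
    rewrite (_ : mass * (N%:R * mass) = N%:R * mass ^+ 2); [lra | ring].
  have h1 : mass * (N%:R * mass) <= D * (mass * X).
    apply: (@le_trans _ _ (1 * (mass * X))).
      by rewrite mul1r ler_wpM2l.
    by rewrite ler_wpM2r// mulr_ge0.
  have h2 : D * (mass * (512 * X + 4 * mass)) <= 516 * (D * (mass * X)).
    rewrite [leRHS]mulrCA ler_wpM2l// [leRHS]mulrCA ler_wpM2l//; lra.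
  lra.
apply: (le_trans step).
have -> : 4133 * D * N%:R ^+ 4 * W = 4133 * D * (N%:R ^+ 2 * X).
  by rewrite /X (mulrA (N%:R ^+ 2)) -exprD mulrA.
by apply: ler_wpM2l; [rewrite mulr_ge0 ?ler0n | exact: ler_wpM2r].
Qed.

End Strips.

(** * The weight as a positive functional *)

Section Plane.
Context {K : realType}.

(** The sigma-algebra of [plane] is that of the Caratheodory-measurable sets,
    which contains the Borel sets. *)
Lemma measurable_plane (A : set (K * K)) :
  measurable A -> measurable (A : set (plane K)).
Proof.
move=> mA; apply: (@sub_caratheodory _ _ _ (@borel_lebesgue2 K)).
exact: sub_sigma_algebra.
Qed.

Lemma measurable_fun_plane (f : K * K -> K) :
  measurable_fun setT f -> measurable_fun setT (f : plane K -> K).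
Proof.
move=> mf _ B mB; rewrite setTI; apply: measurable_plane.
by rewrite -[_ @^-1` _]setTI; exact: mf.
Qed.

Lemma measurable_square (R : K) : measurable (square R).
Proof.
rewrite (_ : square R = (`[0, R] `*` `[0, R])%classic :> set (K * K)).
  by apply: measurable_plane; exact: measurableX.
apply/seteqP; split => z; rewrite /square /= !in_itv /=; first by move/andP.
by move=> [? ?]; apply/andP.
Qed.

Lemma measurable_linear (a b : K) :
  measurable_fun setT (fun z : K * K => a * z.1 + b * z.2).
Proof.
by apply: measurable_funD; exact: measurable_funM.
Qed.

Lemma measurable_cos_linear (a b : K) :
  measurable_fun setT (fun z : K * K => cos (a * z.1 + b * z.2)).
Proof.
apply: measurableT_comp (measurable_linear a b).
by apply: continuous_measurable_fun; exact: continuous_cos.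
Qed.

Lemma measurable_sin_linear (a b : K) :
  measurable_fun setT (fun z : K * K => sin (a * z.1 + b * z.2)).
Proof.
apply: measurableT_comp (measurable_linear a b).
by apply: continuous_measurable_fun; exact: continuous_sin.
Qed.

Lemma measurable_strip (s l : K) :
  measurable_fun setT (fun z : K * K => (s <= z.2 <= s + l)%R%:R : K).
Proof.
rewrite (_ : (fun _ => _) = (\1_`[s, s + l] : K -> K) \o snd).
  by apply: measurableT_comp => //; exact: measurable_indic.
by apply/funext => z; rewrite /= indicE mem_setE in_itv.
Qed.

Lemma measurable_rectangle (c u : K * K) (l1 l2 : K) :
  u.1 ^+ 2 + u.2 ^+ 2 = 1 -> measurable (rectangle c u l1 l2).
Proof.
move=> u1; pose f (z : K * K) := u.1 * z.1 + u.2 * z.2.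
pose g (z : K * K) := - u.2 * z.1 + u.1 * z.2.
rewrite (_ : rectangle c u l1 l2 = ((f @^-1` `[f c, f c + l1]) `&`
    (g @^-1` `[g c, g c + l2]))%classic :> set (K * K)).
  apply: measurable_plane; apply: measurableI.
    by rewrite -[_ @^-1` _]setTI; exact: measurable_linear.
  by rewrite -[_ @^-1` _]setTI; exact: measurable_linear.
apply/seteqP; split => -[x y] /=.
  move=> [r [s [r0 s0 [-> ->]]]]; rewrite !in_itv /=.
  have -> : f (c.1 + r * u.1 - s * u.2, c.2 + r * u.2 + s * u.1) =
      f c + r * (u.1 ^+ 2 + u.2 ^+ 2) by rewrite /f /=; ring.
  have -> : g (c.1 + r * u.1 - s * u.2, c.2 + r * u.2 + s * u.1) =
      g c + s * (u.1 ^+ 2 + u.2 ^+ 2) by rewrite /g /=; ring.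
  by rewrite u1 !mulr1 !lerDl !lerD2l.
rewrite !in_itv /= => -[fz gz]; exists (f (x, y) - f c), (g (x, y) - g c).
split; [lra|lra|]; congr (_, _).
  transitivity (c.1 + (u.1 ^+ 2 + u.2 ^+ 2) * (x - c.1)); first by rewrite u1; ring.
  by rewrite /f /g /=; ring.
transitivity (c.2 + (u.1 ^+ 2 + u.2 ^+ 2) * (y - c.2)); first by rewrite u1; ring.
by rewrite /f /g /=; ring.
Qed.

End Plane.

Section Weighted_integral.
Context {K : realType} (R : K) (omega : plane K -> K).
Hypothesis momega : measurable_fun (square R) omega.
Hypothesis omega_ge0 : forall z, square R z -> 0 <= omega z.
Hypothesis omega_fin : (weight_of R omega (square R) < +oo)%E.

Let mQ := measurable_square R.

Lemma weight_le_total (A : set (plane K)) : measurable A ->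
  (weight_of R omega A <= weight_of R omega (square R))%E.
Proof.
move=> mA; rewrite /weight_of setIid; apply: ge0_subset_integral => //.
- exact: measurableI.
- exact/measurable_EFinP.
Qed.

(** Bounded measurable functions stay integrable when multiplied by [omega]. *)
Definition bounded_test : set (plane K -> K) := [set f : plane K -> K |
  measurable_fun (square R) f /\
  exists B : K, forall z, square R z -> `|f z| <= B].

Definition weighted_integral (f : plane K -> K) : K :=
  \int[@lebesgue2 K]_(z in square R) (f z * omega z).

Lemma weight_integrable :
  (@lebesgue2 K).-integrable (square R) (EFin \o omega).
Proof.
apply/integrableP; split; first exact/measurable_EFinP.
move: omega_fin; rewrite /weight_of setIid; apply: le_lt_trans.
rewrite le_eqVlt; apply/orP; left; apply/eqP; apply: eq_integral => z /=.
by rewrite inE => /omega_ge0 w0; rewrite ger0_norm.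
Qed.

Lemma test_integrable f : bounded_test f ->
  (@lebesgue2 K).-integrable (square R) (EFin \o (fun z => f z * omega z)).
Proof.
move=> [mf [B fB]].
apply: (le_integrable _ _ _ (integrableZl _ B weight_integrable)) => //.
  by apply/measurable_EFinP; exact: measurable_funM.
move=> z Qz /=; rewrite lee_fin !normrM ler_wpM2r//.
by apply: (le_trans (fB z Qz)); exact: ler_norm.
Qed.

Lemma weighted_integralE f : bounded_test f ->
  (\int[@lebesgue2 K]_(z in square R) (f z * omega z)%:E)%E =
  (weighted_integral f)%:E.
Proof.
by move=> tf; rewrite fineK//; apply: integrable_fin_num => //; exact: test_integrable.
Qed.

Lemma bounded_test_cst c : bounded_test (fun=> c).
Proof. by split; [exact: measurable_cst|exists `|c|]. Qed.

Lemma bounded_testD f g : bounded_test f -> bounded_test g ->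
  bounded_test (fun z => f z + g z).
Proof.
move=> [mf [B fB]] [mg [C gC]]; split; first exact: measurable_funD.
exists (B + C) => z Qz; apply: (le_trans (ler_normD _ _)).
by rewrite lerD ?fB ?gC.
Qed.

Lemma bounded_testZ c f : bounded_test f -> bounded_test (fun z => c * f z).
Proof.
move=> [mf [B fB]]; split; first exact: measurable_funM.
by exists (`|c| * B) => z Qz; rewrite normrM ler_wpM2l ?fB.
Qed.

Lemma weighted_integralD f g : bounded_test f -> bounded_test g ->
  weighted_integral (fun z => f z + g z) =
  weighted_integral f + weighted_integral g.
Proof.
move=> tf tg; rewrite /weighted_integral.
under eq_Rintegral do rewrite mulrDl.
by rewrite RintegralD//; exact: test_integrable.
Qed.

Lemma weighted_integralZ c f : bounded_test f ->
  weighted_integral (fun z => c * f z) = c * weighted_integral f.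
Proof.
move=> tf; rewrite /weighted_integral.
under eq_Rintegral do rewrite -mulrA.
by rewrite RintegralZl//; exact: test_integrable.
Qed.

Lemma weighted_integral_ge0 f : bounded_test f ->
  (forall z, square R z -> 0 <= f z) -> 0 <= weighted_integral f.
Proof.
move=> _ f0; apply: Rintegral_ge0 => z Qz.
by rewrite mulr_ge0 ?f0 ?omega_ge0.
Qed.

Definition weight_functional : positive_functional K (plane K) (square R) :=
  Build_positive_functional _ _ _ bounded_test weighted_integral
    bounded_test_cst bounded_testD bounded_testZ
    weighted_integralD weighted_integralZ weighted_integral_ge0.

Lemma linear_phase a b :
  phase weight_functional (fun z : plane K => a * z.1 + b * z.2).
Proof.
split; (split; [|by exists 1 => z _; rewrite ?cos_max ?sin_max]).
  apply: measurable_funTS; apply: measurable_fun_plane; exact: measurable_cos_linear.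
apply: measurable_funTS; apply: measurable_fun_plane; exact: measurable_sin_linear.
Qed.

Lemma strip_bounded_test s l :
  bounded_test (fun z : plane K => (s <= z.2 <= s + l)%R%:R).
Proof.
split.
  by apply: measurable_funTS; apply: measurable_fun_plane; exact: measurable_strip.
by exists 1 => z _; case: (_ && _); rewrite ?normr1 ?normr0.
Qed.

Lemma mass_weight : (weighted_integral (fun=> 1))%:E = weight_of R omega (square R).
Proof.
rewrite -weighted_integralE; last exact: bounded_test_cst.
by rewrite /weight_of setIid; under eq_integral do rewrite mul1r.
Qed.

(** The tube with lower left corner (0, s) and long side horizontal meets the
    square in the strip s <= t <= s + l. *)
Lemma strip_weight s l : 0 <= R ->
  (weighted_integral (fun z => (s <= z.2 <= s + l)%R%:R))%:E =
  weight_of R omega (rectangle (0, s) (1, 0) R l).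
Proof.
move=> R0; rewrite -weighted_integralE; last exact: strip_bounded_test.
have -> : weight_of R omega (rectangle (0, s) (1, 0) R l) =
  weight_of R omega [set z | s <= z.2 <= s + l].
  congr (integral _ _ _); apply/seteqP; split => -[x t] /=.
    move=> [[r [q [/andP[r0 rR] /andP[q0 ql] [-> ->]]]] Q].
    by split => //; rewrite mulr0 mulr1 addr0; lra.
  move=> [/andP[st tl] Q]; split => //; exists x, (t - s).
  move: Q; rewrite /square /= => /andP[xR _]; split => //; first lra.
  by congr (_, _); ring.
rewrite /weight_of setIC integral_mkcondr; apply: eq_integral => z _.
rewrite /patch; case: ifPn => [|/negP]; rewrite inE /=.
  by move=> ->; rewrite mul1r.
by move=> /negP/negbTE ->; rewrite mul0r.
Qed.

End Weighted_integral.

(** * The weighted estimate *)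

Lemma sum_Complex {K : realType} (J : Type) (r : seq J) (x y : J -> K) :
  \sum_(j <- r) Complex (x j) (y j) = Complex (\sum_(j <- r) x j) (\sum_(j <- r) y j).
Proof.
by elim/big_rec3: _ => // j a b c _ ->.
Qed.

Lemma normcX2 {K : realType} (x y : K) :
  Normc.normc (Complex x y) ^+ 2 = x ^+ 2 + y ^+ 2.
Proof. by rewrite /Normc.normc sqr_sqrtr// addr_ge0// sqr_ge0. Qed.

Lemma normc_GX2 {K : realType} (R : K) (N : nat) (a : nat -> K[i]) (z : plane K) :
  let al (j : 'I_N) := 2 * pi *
    (j.+1%:R / Num.sqrt R * z.1 + j.+1%:R ^+ 2 / R * z.2) in
  let x (j : 'I_N) := complex.Re (a j.+1) in
  let y (j : 'I_N) := complex.Im (a j.+1) in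
  Normc.normc (G R N a z) ^+ 2 =
  (\sum_j (x j * cos (al j) - y j * sin (al j))) ^+ 2 +
  (\sum_j (x j * sin (al j) + y j * cos (al j))) ^+ 2.
Proof.
move=> al x y; rewrite -normcX2 -sum_Complex /G big_add1 big_mkord /=.
congr (Normc.normc _ ^+ 2); apply: eq_bigr => j _.
by rewrite /x /y /e; case: (a j.+1).
Qed.

Theorem theorem1p5 (K : realType) (eps : K) (heps : 0 < eps) :
  exists2 C : K, 0 < C &
  forall (R : K) (N : nat) (omega : plane K -> K) (a : nat -> K[i]),
    1 <= R ->
    Num.sqrt R = N%:R ->
    measurable_fun (square R) omega ->
    (forall z, square R z -> 0 <= omega z) ->
    (weight_of R omega (square R) <= R%:E)%E ->
    (\int[@lebesgue2 K]_(z in square R)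
        (Normc.normc (G R N a z) ^+ 2 * omega z)%:E
     <= (C * R `^ eps)%:E
        * ereal_sup [set poweR (weight_of R omega T) 2^-1 | T in tube R]
        * (R * \sum_(1 <= n < N.+1) Normc.normc (a n) ^+ 2)%:E)%E.
Proof.
have [C0 C00 hC0] := size_divisors_le_powR (2 * eps) (mulr_gt0 (ltr0Sn K 1) heps).
(* D below is the divisor bound at 64 N^2; C1 collects the constants of 4133 D *)
pose C1 : K := 4133 * (C0 * 64 `^ (2 * eps)).
have C10 : 0 <= C1 by rewrite !mulr_ge0 ?powR_ge0 ?ler0n.
exists (Num.sqrt C1 + 1); first by rewrite ltr_wpDl ?sqrtr_ge0.
set C := _ + 1.
have CC1 : C1 <= C ^+ 2.
  rewrite -[leLHS]sqr_sqrtr// lerXn2r ?nnegrE ?sqrtr_ge0 ?addr_ge0 ?sqrtr_ge0//.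
  by rewrite lerDl.
have C_ge0 : 0 <= C by rewrite addr_ge0 ?sqrtr_ge0.
move=> R N omega a R1 sqrtR momega omega0 wR.
have R0 : 0 < R by apply: lt_le_trans R1.
have RN : R = N%:R ^+ 2 by rewrite -sqrtR sqr_sqrtr// ltW.
have N0 : (0 < N)%N by rewrite -(ltr0n K) -sqrtR sqrtr_gt0.
have wfin : (weight_of R omega (square R) < +oo)%E.
  by apply: le_lt_trans wR _; rewrite ltry.
pose I := weight_functional R omega momega omega0 wfin.
pose strip (s : K) (z : plane K) : K := (s <= z.2 <= s + N%:R)%R%:R.
set S := ereal_sup _.
have tube_strip s : tube R (rectangle (0, s) (1, 0) R (Num.sqrt R)).
  by exists (0, s), (1, 0) => /=; split => //; ring.
have mass_le : pfun I (fun=> 1) <= R.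
  by rewrite -lee_fin mass_weight.
have strip_S s : ((pfun I (strip s) `^ 2^-1)%:E <= S)%E.
  apply: ereal_sup_ubound; exists (rectangle (0, s) (1, 0) R (Num.sqrt R)).
    exact: tube_strip.
  rewrite sqrtR -(strip_weight R omega momega omega0 wfin s _ (ltW R0)).
  exact: poweR_EFin.
have S0 : (0 <= S)%E.
  by apply: le_trans (strip_S 0); rewrite lee_fin powR_ge0.
(* finiteness of the supremum: no tube is heavier than the whole square *)
have Sfin : S \is a fin_num.
  rewrite ge0_fin_numE//; apply: (@le_lt_trans _ _ (poweR R%:E 2^-1)).
    apply: ge_ereal_sup => _ [_ [c [u [u1 ->]]] <-].
    apply: gt0_ler_poweR; rewrite ?invr_ge0//.
    - rewrite /= in_itv /= leey andbT; apply: integral_ge0 => z [_ /omega0].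
      by rewrite lee_fin.
    - by rewrite /= in_itv /= leey andbT lee_fin ltW.
    apply: le_trans wR; apply: weight_le_total => //.
    exact: measurable_rectangle.
  by rewrite poweR_EFin ltry.
set sg := fine S.
have sg0 : 0 <= sg by exact: fine_ge0.
(* W = sg^2, so that the sup of the square roots is W^(1/2) = sg *)
have strip_le s : pfun I (strip s) <= sg ^+ 2.
  have p0 : 0 <= pfun I (strip s).
    apply: pfun_ge0; first exact: strip_bounded_test.
    by move=> z _; rewrite /strip ler0n.
  have : pfun I (strip s) `^ 2^-1 <= sg by rewrite -lee_fin fineK.
  rewrite powR12_sqrt// => h.
  by rewrite -[leLHS]sqr_sqrtr// lerXn2r ?nnegrE ?sqrtr_ge0.
pose D := C0 * (64 * N ^ 2)%N%:R `^ (2 * eps).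
pose al (j : 'I_N) (z : plane K) := 2 * pi *
    (j.+1%:R / Num.sqrt R * z.1 + j.+1%:R ^+ 2 / R * z.2).
have NR0 : N%:R != 0 :> K by rewrite pnatr_eq0 -lt0n.
have alB i j : (fun z => al i z - al j z) = (fun z : plane K =>
    (i.+1%:R - j.+1%:R) * (2 * pi / N%:R) * z.1 +
    (i.+1%:R ^+ 2 - j.+1%:R ^+ 2) * (2 * pi / N%:R ^+ 2) * z.2).
  by apply/funext => z; rewrite /al sqrtR RN; field.
have tauQ z : square R z -> 0 <= z.2 <= N%:R ^+ 2.
  by rewrite -RN => /andP[].
have massN : pfun I (fun=> 1) <= N%:R ^+ 2 by rewrite -RN.
have energies := parabola_energy_le I fst snd N (sg ^+ 2) N0
  (linear_phase _ _ _ _ _) tauQ (fun s => strip_bounded_test _ _ _)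
  strip_le massN D (fun j => hC0 j _).
have palB i j : phase I (fun z => al i z - al j z).
  by rewrite alB; exact: linear_phase.
have key := pfun_square_modulus_le I _ (fun j : 'I_N => complex.Re (a j.+1))
  (fun j : 'I_N => complex.Im (a j.+1)) al palB.
set F := fun z : plane K => _ in key.
have tF : bounded_test R F by exact: (test_square_modulus I).
have GF z : Normc.normc (G R N a z) ^+ 2 = F z by exact: normc_GX2.
set A := \sum_(1 <= n < N.+1) _.
have AE : A = \sum_(j < N) (complex.Re (a j.+1) ^+ 2 + complex.Im (a j.+1) ^+ 2).
  rewrite /A big_add1 big_mkord; apply: eq_bigr => j _.
  by case: (a j.+1) => x y; rewrite normcX2.
under eq_integral do rewrite GF.
rewrite weighted_integralE// -(fineK Sfin) -/sg -!EFinM lee_fin.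
rewrite -AE in key.
have V0 : 0 <= weighted_integral R omega F.
  apply: (weighted_integral_ge0 R omega omega0 F tF) => z _.
  by rewrite addr_ge0 ?sqr_ge0.
have A0 : 0 <= A by rewrite AE sumr_ge0// => j _; rewrite addr_ge0 ?sqr_ge0.
have Re0 : 0 <= R `^ eps by exact: powR_ge0.
have RE : R `^ (2 * eps) = (R `^ eps) ^+ 2 by rewrite mulrC powRrM powR_mulrn.
have DE : 4133 * D = C1 * (R `^ eps) ^+ 2.
  by rewrite /D /C1 natrM natrX -RN powRM ?ler0n ?(ltW R0)// RE !mulrA.
have RHS0 : 0 <= C * R `^ eps * sg * (R * A).
  by apply: mulr_ge0; apply: mulr_ge0 => //; [exact: mulr_ge0 | exact: ltW].
rewrite -(@ler_pXn2r _ 2%N) ?nnegrE//; apply: (le_trans key).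
apply: (@le_trans _ _ (A ^+ 2 * (C1 * (R `^ eps) ^+ 2 * N%:R ^+ 4 * sg ^+ 2))).
  rewrite ler_wpM2l ?sqr_ge0// -DE; apply: le_trans energies.
  rewrite le_eqVlt; apply/orP; left; apply/eqP.
  by apply: eq_bigr => i _; apply: eq_bigr => j _; rewrite alB.
have -> : (C * R `^ eps * sg * (R * A)) ^+ 2 =
    C ^+ 2 * ((R `^ eps) ^+ 2 * N%:R ^+ 4 * sg ^+ 2 * A ^+ 2) by rewrite {2}RN; ring.
have -> : A ^+ 2 * (C1 * (R `^ eps) ^+ 2 * N%:R ^+ 4 * sg ^+ 2) =
    C1 * ((R `^ eps) ^+ 2 * N%:R ^+ 4 * sg ^+ 2 * A ^+ 2) by ring.
by apply: ler_wpM2r => //; rewrite !mulr_ge0 ?sqr_ge0 ?exprn_ge0 ?ler0n.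
Qed.
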